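(* $$\lim_{H\to\infty}\frac{D_2^*(H)}{(2H)^3}=\frac{41+6\log 2}{72},$$ where, for a positive integer $H$, $D_2^*(H)$ denotes the number of dominant polynomials $f(X)=a_0X^2+a_1X+a_2\in\mathbb{Z}[X]$ with $a_0\ne 0$ and $|a_i|\le H$ for $i=0,1,2$.
   Context: A quadratic polynomial $f\in\mathbb{C}[X]$ with roots $\alpha_1,\alpha_2\in\mathbb{C}$ (listed with multiplicity) is called dominant if $|\alpha_1|\ne|\alpha_2|$, i.e. one of the roots has modulus strictly greater than that of the other. $H$ runs through positive integers, and $\log$ is the natural logarithm. *)

(* Defs.v *)
From HB Require Import structures.
From mathcomp Require Import all_boot all_order all_algebra.
From mathcomp Require Import finmap complex.
From mathcomp Require Import all_classical all_reals all_analysis.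

Set Implicit Arguments.
Unset Strict Implicit.
Unset Printing Implicit Defensive.

Import Order.TTheory GRing.Theory Num.Theory.
Import numFieldNormedType.Exports.

Local Open Scope classical_set_scope.
Local Open Scope ring_scope.

(* The factorization lists the two roots with multiplicity; it exists because
   R[i] is algebraically closed and is unique up to swapping alpha1, alpha2. *)
Definition dominant (R : realType) (f : {poly R[i]}) : Prop :=
  size f = 3%N /\
  exists alpha1 alpha2 : R[i],
    f = lead_coef f *: (('X - alpha1%:P) * ('X - alpha2%:P)) /\
    `|alpha1| <> `|alpha2|.

(* size f = 3 says that the coefficient of 'X^2 is nonzero. *)
Definition dominant_quadratics (R : realType) (H : nat) : set {poly int} :=
  [set f : {poly int} |
    [/\ size f = 3%N,
        forall i : nat, (i < 3)%N -> `|f`_i| <= H%:Z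
      & dominant (map_poly (intr : int -> R[i]) f)]].

(* Needed for D2 to be a genuine count: fset_set is set0 on infinite sets. *)
Lemma finite_dominant_quadratics (R : realType) (H : nat) :
  finite_set (dominant_quadratics R H).
Proof.
pose c (k : 'I_(H + H).+1) : int := k%:Z - H%:Z.
pose F (t : {ffun 'I_3 -> 'I_(H + H).+1}) : {poly int} :=
  \poly_(i < 3) c (t (inord i)).
apply: (@sub_finite_set _ _ (range F)); last first.
  by apply: finite_image; exact: finite_finset.
move=> f [sf bf _].
exists [ffun i : 'I_3 => inord (absz (f`_i + H%:Z))] => //.
apply/polyP => i; rewrite coef_poly; case: ltnP => [i3|i3]; last first.
  by rewrite nth_default // sf.
have := bf _ i3; rewrite ler_norml => /andP[lo hi].
have ge0 : 0 <= f`_i + H%:Z by rewrite -lerBlDr sub0r.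
rewrite /c ffunE !inordK ?addrK //.
  by rewrite gez0_abs // addrK.
by rewrite ltnS -lez_nat gez0_abs // PoszD lerD2r.
Qed.

Definition D2 (R : realType) (H : nat) : nat :=
  #|` fset_set (dominant_quadratics R H)|%fset.

(* Main.v *)
(* An integer quadratic a X^2 + b X + c has roots of distinct moduli iff b <> 0
   and 4ac < b^2: otherwise the roots are opposite, equal or conjugate. The sign
   patterns with ac <= 0 impose no further condition and contribute
   4 (H^2 + H^3), while those with ac > 0 contribute 4 T(H), where T(H) counts
   the (a, b, c) in [1, H]^3 with 4ac < b^2. For fixed b the count over (a, c)
   is sum_a min(H, b^2 / 4a) up to H, which is within H of the integral
   b^2/4 (1 + 2 log 2 + 2 log (H / b)). Summing over b, by Abel summation for
   the logarithmic term, gives T(H) = (5 + 6 log 2)/36 H^3 + O(H^2). *)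

Require Import Defs.
From HB Require Import structures.
From mathcomp Require Import all_boot all_order all_algebra.
From mathcomp Require Import finmap complex.
From mathcomp Require Import all_classical all_reals all_analysis.
From mathcomp Require Import ring lra zify.

Set Implicit Arguments.
Unset Strict Implicit.
Unset Printing Implicit Defensive.

Import Order.TTheory GRing.Theory Num.Theory.
Import numFieldNormedType.Exports.

Local Open Scope classical_set_scope.
Local Open Scope ring_scope.

Local Open Scope complex_scope.

(** * Dominance as a condition on the coefficients *)

(** A real sum makes the imaginary parts opposite, say [y1] and [- y1], and a real product then
    gives [y1 * (x2 - x1) = 0]. Equal moduli mean [x1 = x2] or [x1 + x2 = 0]; the latter is [b = 0],
    and the discriminant is [a ^+ 2 * ((x1 - x2) ^+ 2 - 4 * y1 ^+ 2)]. *)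
Lemma eq_norm_real_quadratic (R : rcfType) (a b c : R) (alpha1 alpha2 : R[i]) :
  a != 0 -> a%:C * (alpha1 + alpha2) = - b%:C -> a%:C * (alpha1 * alpha2) = c%:C ->
  `|alpha1| = `|alpha2| <-> b = 0 \/ b ^+ 2 <= 4 * a * c.
Proof.
case: alpha1 alpha2 => [x1 y1] [x2 y2] a0.
move/eqP; rewrite eq_complex /= !mul0r !subr0 !addr0 oppr0 => /andP[/eqP eb].
rewrite mulf_eq0 (negPf a0) /= addrC addr_eq0 => /eqP ->.
move/eqP; rewrite eq_complex /= !mul0r !subr0 !addr0 => /andP[/eqP ec].
rewrite mulf_eq0 (negPf a0) /= => /eqP exy.
have -> : b = - (a * (x1 + x2)) by rewrite eb opprK.
rewrite -{}ec !normc_def /= sqrrN.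
have a2 : 0 < a ^+ 2 by rewrite exprn_even_gt0.
have -> : (Num.sqrt (x1 ^+ 2 + y1 ^+ 2))%:C = (Num.sqrt (x2 ^+ 2 + y1 ^+ 2))%:C
    <-> (x1 - x2) * (x1 + x2) = 0.
  rewrite -subr_sqr; split=> [[] /eqP|/eqP].
    by rewrite eqr_sqrt ?addr_ge0 ?sqr_ge0 // => /eqP ?; lra.
  by rewrite subr_eq0 => /eqP ->.
have -> : (- (a * (x1 + x2))) ^+ 2 <= 4 * a * (a * (x1 * x2 - y1 * - y1))
    <-> (x1 - x2) ^+ 2 <= 4 * y1 ^+ 2.
  rewrite -[(x1 - x2) ^+ 2 <= _](ler_pM2l a2); split; lra.
split=> [/eqP|].
  rewrite mulf_eq0 => /orP[/eqP ->|/eqP ->]; last by left; rewrite mulr0 oppr0.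
  by right; rewrite expr0n /= mulr_ge0 ?sqr_ge0.
case=> [/eqP|le];
  first by rewrite oppr_eq0 mulf_eq0 (negPf a0) => /eqP ->; rewrite mulr0.
suff -> : x1 = x2 by rewrite subrr mul0r.
have /eqP : y1 * (x2 - x1) = 0 by rewrite -exy; ring.
rewrite mulf_eq0 subr_eq0 => /orP[/eqP y0|/eqP -> //].
move: le; rewrite y0 expr0n /= mulr0 => le; apply/eqP; rewrite -subr_eq0.
by rewrite -sqrf_eq0 eq_le le sqr_ge0.
Qed.

Lemma dominantP (R : realType) (f : {poly int}) : size f = 3%N ->
  dominant (map_poly (intr : int -> R[i]) f) <->
  f`_1 != 0 /\ 4 * f`_2 * f`_0 < f`_1 ^+ 2.
Proof.
move=> sf.
have f2 : f`_2 != 0 by rewrite -[2%N]/(3.-1) -sf lead_coef_eq0 -size_poly_eq0 sf.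
pose g := map_poly (intr : int -> R[i]) f.
have sg : size g = 3%N.
  by rewrite size_map_inj_poly // => x y /eqP; rewrite eqr_int => /eqP.
have gE i : g`_i = ((f`_i)%:~R : R)%:C by rewrite coef_map_id0 // rmorph_int.
have lg : lead_coef g = ((f`_2)%:~R : R)%:C by rewrite lead_coefE sg gE.
(* Vieta's relations. *)
have eqg x y : g = lead_coef g *: (('X - x%:P) * ('X - y%:P)) <->
    ((f`_2)%:~R : R)%:C * (x + y) = - ((f`_1)%:~R : R)%:C /\
    ((f`_2)%:~R : R)%:C * (x * y) = ((f`_0)%:~R : R)%:C.
  have -> : ('X - x%:P) * ('X - y%:P) = 'X^2 - (x + y) *: 'X + (x * y)%:P.
    by rewrite -mul_polyC polyCM polyCD; ring.
  rewrite lg; split=> [E|[E1 E0]].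
    have := congr1 (fun p : {poly _} => p`_0) E.
    have := congr1 (fun p : {poly _} => p`_1) E.
    rewrite !gE !(coefZ, coefD, coefN, coefC, coefX, coefXn) /= => -> ->.
    by split; ring.
  apply/polyP => i; rewrite !(coefZ, coefD, coefN, coefC, coefX, coefXn).
  case: i => [|[|[|i]]] /=; rewrite ?gE.
  - by rewrite -E0; ring.
  - by rewrite -[LHS]opprK -E1; ring.
  - by ring.
  - by rewrite nth_default ?sf // rmorph0; ring.
have f2R : ((f`_2)%:~R : R) != 0 by rewrite intr_eq0.
have cond : f`_1 != 0 /\ 4 * f`_2 * f`_0 < f`_1 ^+ 2 <->
    ~ (((f`_1)%:~R : R) = 0 \/ ((f`_1)%:~R : R) ^+ 2 <= 4 * (f`_2)%:~R * (f`_0)%:~R).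
  have -> : ((f`_1)%:~R : R) ^+ 2 <= 4 * (f`_2)%:~R * (f`_0)%:~R <->
      ~~ (4 * f`_2 * f`_0 < f`_1 ^+ 2).
    rewrite -leNgt -(ler_int R) rmorphXn !rmorphM /=; split=> //.
  split=> [[f1 lt] [/eqP|]|N]; first by rewrite intr_eq0 (negPf f1).
    by rewrite lt.
  split; first by apply/eqP => f1; apply: N; left; rewrite f1.
  by apply: contrapT => /negP lt; apply: N; right.
rewrite cond; split.
  by case=> _ [x [y [/eqg[E1 E0] nxy]]] /(eq_norm_real_quadratic f2R E1 E0).
move=> N; split=> //.
set A : R := (f`_2)%:~R in f2R *; set B : R := (f`_1)%:~R in N *.
set C : R := (f`_0)%:~R in N *.
have d0 : 0 <= B ^+ 2 - 4 * A * C.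
  by rewrite subr_ge0 leNgt; apply/negP => lt; apply: N; right; exact: ltW.
(* The discriminant is nonnegative, so the quadratic formula supplies real roots as witnesses. *)
pose r := Num.sqrt (B ^+ 2 - 4 * A * C).
have rr : r ^+ 2 = B ^+ 2 - 4 * A * C by rewrite sqr_sqrtr.
pose x := (- B + r) / (2 * A); pose y := (- B - r) / (2 * A).
have E1 : A%:C * (x%:C + y%:C) = - B%:C.
  by rewrite -rmorphD -rmorphM -rmorphN; congr _%:C; rewrite /x /y; field.
have E0 : A%:C * (x%:C * y%:C) = C%:C.
  rewrite -!rmorphM; congr _%:C.
  have -> : A * (x * y) = (B ^+ 2 - r ^+ 2) / (4 * A) by rewrite /x /y; field.
  by rewrite rr; field.
exists x%:C, y%:C; split; first by apply/eqg.
by move/(eq_norm_real_quadratic f2R E1 E0).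
Qed.

Local Close Scope complex_scope.

(** * Reduction to counting triples of positive integers *)

(** Separating the sign from the absolute value lets sums over coefficients split by sign pattern;
    the shift by one excludes zero. *)
Definition signed (n : nat) (x : bool * 'I_n) : int :=
  (-1) ^+ x.1 * x.2.+1%:Z.

Lemma signed_inj n : injective (@signed n).
Proof.
move=> [s i] [t j]; rewrite /signed /= => e.
have /eqP : `|(-1) ^+ s * i.+1%:Z| = `|(-1) ^+ t * j.+1%:Z| by rewrite e.
rewrite !normrMsign /= eqz_nat eqSS => /eqP /val_inj ij.
by move: e; rewrite ij; case: s t => -[] //; lia.
Qed.

Lemma signed_neq0 n (x : bool * 'I_n) : signed x != 0.
Proof. by rewrite /signed mulf_neq0 ?signr_eq0. Qed.

Lemma normr_signed n (x : bool * 'I_n) : `|signed x| <= n%:Z.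
Proof. by rewrite /signed normrMsign; exact: ltn_ord. Qed.

Lemma signed_surj n (z : int) : z != 0 -> `|z| <= n%:Z ->
  exists x : bool * 'I_n, signed x = z.
Proof.
move=> z0 zn; have lt : (`|z|%N.-1 < n)%N by lia.
exists (z < 0, Ordinal lt); rewrite /signed /= prednK ?absz_gt0 //.
by rewrite abszE -numEsign.
Qed.

(* The middle and leading coefficients [t.1.1] and [t.1.2] are nonzero; the
   constant coefficient may vanish, whence the option type. *)
Definition quadratic (n : nat)
  (t : (bool * 'I_n) * (bool * 'I_n) * option (bool * 'I_n)) : {poly int} :=
  Poly [:: if t.2 is Some z then signed z else 0; signed t.1.1; signed t.1.2].

Definition pos_disc (n : nat)
  (t : (bool * 'I_n) * (bool * 'I_n) * option (bool * 'I_n)) : bool :=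
  4 * signed t.1.2 * (if t.2 is Some z then signed z else 0)
    < signed t.1.1 ^+ 2.

Lemma quadratic_seq n t : @quadratic n t =
  [:: if t.2 is Some z then signed z else 0; signed t.1.1; signed t.1.2]
    :> seq int.
Proof. by apply: (@PolyK _ 0); rewrite /= signed_neq0. Qed.

Lemma quadratic_inj n : injective (@quadratic n).
Proof.
move=> [[x y] z] [[x' y'] z'] /(congr1 polyseq); rewrite !quadratic_seq /=.
case=> ez /signed_inj -> /signed_inj ->; congr (_, _).
case: z z' ez => [z|] [z'|] //; first by move/signed_inj->.
  by move/eqP; rewrite (negPf (signed_neq0 _)).
by move/esym/eqP; rewrite (negPf (signed_neq0 _)).
Qed.

Lemma dominant_quadraticsE (R : realType) (H : nat) :
  dominant_quadratics R H = [set @quadratic H t | t in [set t | pos_disc t]].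
Proof.
apply/seteqP; split=> f /=.
  case=> sf bf /(dominantP R sf) [f1 df].
  have f2 : f`_2 != 0 by rewrite -[2%N]/(3.-1) -sf lead_coef_eq0 -size_poly_eq0 sf.
  have [x ex] := signed_surj f1 (bf 1%N isT).
  have [y ey] := signed_surj f2 (bf 2%N isT).
  have [z ez] : exists z : option (bool * 'I_H),
      (if z is Some z then signed z else 0) = f`_0.
    have [f0|f0] := eqVneq f`_0 0; first by exists None.
    by have [z ez] := signed_surj f0 (bf 0%N isT); exists (Some z).
  exists (x, y, z); first by rewrite /pos_disc /= ex ey ez.
  apply/polyP => i; rewrite quadratic_seq /= ex ey ez.
  by case: i => [|[|[|i]]] //=; rewrite !nth_default ?sf.
case=> t dt <-; have st : size (quadratic t) = 3%N by rewrite quadratic_seq.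
split=> //; last by apply/dominantP; rewrite // quadratic_seq /= signed_neq0.
rewrite quadratic_seq; case=> [|[|[|i]]] //= _; rewrite ?normr_signed //.
by case: t.2 => [z|]; rewrite ?normr_signed ?normr0.
Qed.

(** This is $T(n)$; the outermost index [j] stands for the middle coefficient, which stays fixed in
    the estimates of the inner double sum. *)
Definition pos_disc_triples (n : nat) : nat :=
  \sum_(j < n) \sum_(i < n) \sum_(k < n) (4 * i.+1 * k.+1 < j.+1 ^ 2).

Lemma big_option (R : Type) (idx : R) (op : Monoid.com_law idx) (I : finType)
    (F : option I -> R) :
  \big[op/idx]_x F x = op (F None) (\big[op/idx]_i F (Some i)).
Proof.
rewrite (bigD1 None) //=; congr (op _ _).
rewrite (reindex_omap Some id) /=; last by case.
by apply: eq_bigl => i; rewrite eqxx.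
Qed.

Lemma sum_pos_disc n :
  (\sum_(t : (bool * 'I_n) * (bool * 'I_n) * option (bool * 'I_n)) pos_disc t
    = 4 * (n ^ 2 + n ^ 3 + pos_disc_triples n))%N.
Proof.
rewrite -(pair_bigA _ (fun p z => pos_disc (p, z) : nat)) /=.
rewrite -(pair_bigA _ (fun x y => \sum_z (pos_disc (x, y, z) : nat))%N) /=.
rewrite -(pair_bigA _ (fun s j => \sum_y \sum_z (pos_disc ((s, j), y, z) : nat))%N) /=.
have E s (j : 'I_n) : (\sum_y \sum_z (pos_disc ((s, j), y, z) : nat)
    = 2 * (n + n ^ 2 + \sum_(i < n) \sum_(k < n) (4 * i.+1 * k.+1 < j.+1 ^ 2)))%N.
  rewrite -(pair_bigA _ (fun u i => \sum_z (pos_disc ((s, j), (u, i), z) : nat))%N) /=.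
  (* The three terms come from a zero constant coefficient, from one of sign opposite to the leading
     coefficient, and from one of the same sign. *)
  have E u (i : 'I_n) : (\sum_z (pos_disc ((s, j), (u, i), z) : nat)
      = 1 + (n + \sum_(k < n) (4 * i.+1 * k.+1 < j.+1 ^ 2)))%N.
    have pd z : pos_disc ((s, j), (u, i), Some z) =
        (u != z.1) || (4 * i.+1 * z.2.+1 < j.+1 ^ 2)%N.
      rewrite /pos_disc /signed /= exprMn sqrr_sign mul1r; case: z => v k /=.
      rewrite expr2 -mulnn; case: u v => -[] /=; rewrite ?expr0 ?expr1; nia.
    rewrite big_option /= {1}/pos_disc /= mulr0 exprn_even_gt0 ?signed_neq0 //.
    congr (_ + _)%N.
    rewrite -(pair_bigA _ (fun v k => pos_disc ((s, j), (u, i), Some (v, k)) : nat)).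
    rewrite big_bool /=.
    have Eeq : (\sum_(k < n) (pos_disc ((s, j), (u, i), Some (u, k)) : nat) =
        \sum_(k < n) (4 * i.+1 * k.+1 < j.+1 ^ 2))%N.
      by apply: eq_bigr => k _; rewrite pd eqxx.
    have Eneq : (\sum_(k < n) (pos_disc ((s, j), (u, i), Some (~~ u, k)) : nat) = n)%N.
      rewrite -[RHS]card_ord -sum1_card; apply: eq_bigr => k _.
      by rewrite pd; case: (u).
    by case: u Eeq Eneq {pd} => /= -> ->; rewrite // addnC.
  under eq_bigr => u _ do under eq_bigr => i _ do rewrite E.
  rewrite big_bool /= !big_split /= !sum_nat_const !card_ord; lia.
under eq_bigr => s _ do under eq_bigr => j _ do rewrite E.
rewrite big_bool /= -!big_distrr /= !big_split /= !sum_nat_const !card_ord.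
by rewrite mulnn -expnS addnn -mul2n mulnA.
Qed.

Lemma D2E (R : realType) (H : nat) :
  (D2 R H = 4 * (H ^ 2 + H ^ 3 + pos_disc_triples H))%N.
Proof.
rewrite -sum_pos_disc /D2 dominant_quadraticsE fset_set_image;
  last exact: finite_finset.
rewrite card_imfset; last exact: quadratic_inj.
rewrite -[RHS]big_mkcond sum1_card cardE /=; apply/perm_size/uniq_perm.
- exact: fset_uniq.
- exact: enum_uniq.
move=> t; rewrite mem_enum in_fset_set; last exact: finite_finset.
by rewrite mem_setE.
Qed.

(** * Truncated harmonic sums *)

(* The antiderivative of [min 1 (1 / u)] vanishing at 0; it is concave, so the
   tangent inequality below bounds sums of its derivative by telescoping. *)
Definition loghinge (R : realType) (u : R) : R := if u <= 1 then u else 1 + ln u.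

Lemma ln_le_subr1 (R : realType) (x : R) : 0 < x -> ln x <= x - 1.
Proof.
move=> x0; have := @le_ln1Dx R (x - 1).
by rewrite [1 + _]addrC subrK; apply; rewrite ltrBrDr addNr.
Qed.

(** When [u] and [v] are not both at most 1, this is [ln x <= x - 1] at [u], [v^-1] or [v^-1 * u],
    according to which of them exceed 1. *)
Lemma loghinge_tangent (R : realType) (u v : R) : 0 <= u -> 0 < v ->
  loghinge u <= loghinge v + Num.min 1 v^-1 * (u - v).
Proof.
move=> u0 v0; rewrite /loghinge.
have vV0 : 0 < v^-1 by rewrite invr_gt0.
have vVv : v^-1 * v = 1 by rewrite mulVf ?gt_eqF.
case: (leP v 1) => v1.
  have vV1 : 1 <= v^-1 by rewrite invf_ge1.
  rewrite (min_idPl vV1) mul1r [v + _]addrC subrK; case: (leP u 1) => // u1.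
  by have := ln_le_subr1 (lt_trans ltr01 u1); lra.
have vV1 : v^-1 < 1 by rewrite invf_lt1.
rewrite (min_idPr (ltW vV1)) mulrBr vVv; case: (leP u 1) => u1.
  have := ln_le_subr1 vV0; rewrite lnV ?posrE //; nra.
have u_gt0 : 0 < u by lra.
have := @ln_le_subr1 R (v^-1 * u) (mulr_gt0 vV0 u_gt0).
by rewrite lnM ?posrE // lnV ?posrE //; lra.
Qed.

Lemma sum_min_harmonic (R : realType) (q : R) (n : nat) : 0 < q ->
  loghinge (n%:R * q) - q <= \sum_(i < n) q * Num.min 1 (i.+1%:R * q)^-1
    <= loghinge (n%:R * q).
Proof.
move=> q0.
have h0 : loghinge (0 : R) = 0 by rewrite /loghinge ler01.
have pos i : 0 < i.+1%:R * q by rewrite mulr_gt0 ?ltr0n.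
have nn i : 0 <= i%:R * q by rewrite mulr_ge0 ?ler0n ?ltW.
apply/andP; split; last first.
  elim: n => [|n IH]; first by rewrite big_ord0 mul0r h0.
  rewrite big_ord_recr /=.
  have := loghinge_tangent (nn n) (pos n); rewrite -[n.+1%:R]natr1; lra.
(* With the argument shifted by one step, the tangent at each sample point bounds the increment to
   its right, and the sum telescopes down to [loghinge q <= q]. *)
suff H : loghinge (n.+1%:R * q) - q <=
    \sum_(i < n) q * Num.min 1 (i.+1%:R * q)^-1.
  apply: le_trans H; rewrite lerD2r.
  have := loghinge_tangent (nn n) (pos n).
  have : 0 <= Num.min 1 (n.+1%:R * q)^-1.
    by rewrite le_min ler01 invr_ge0 nn.
  by rewrite -[n.+1%:R]natr1; nra.
elim: n => [|n IH].
  have := loghinge_tangent (nn 1%N) q0; rewrite big_ord0 !mul1r /loghinge.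
  case: (leP q 1) => q1; first lra.
  by have := ln_le_subr1 q0; lra.
rewrite big_ord_recr /=.
have := loghinge_tangent (nn n.+2) (pos n); rewrite -[n.+2%:R]natr1; lra.
Qed.

(** * The sum of squares weighted by logarithms *)

Definition sumsq_log (R : realType) (n : nat) : R :=
  \sum_(j < n) j.+1%:R ^+ 2 * (ln n%:R - ln j.+1%:R).

Lemma sum_sqr (R : realType) (n : nat) :
  \sum_(j < n) j.+1%:R ^+ 2 = n%:R * (n%:R + 1) * (2 * n%:R + 1) / 6 :> R.
Proof.
elim: n => [|n IH]; first by rewrite big_ord0 !mul0r.
by rewrite big_ord_recr /= IH -[n.+1%:R]natr1; field.
Qed.

(** Abel summation in incremental form: the new last term vanishes, and all earlier logarithms grow
    by the same amount. *)
Lemma sumsq_logS (R : realType) (n : nat) :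
  sumsq_log R n.+1 = sumsq_log R n +
    (ln n.+1%:R - ln n%:R) * \sum_(j < n) j.+1%:R ^+ 2.
Proof.
rewrite /sumsq_log big_ord_recr /= subrr mulr0 addr0 mulr_sumr -big_split /=.
by apply: eq_bigr => j _; ring.
Qed.

Lemma ln_succ_bounds (R : realType) (n : nat) : (0 < n)%N ->
  n.+1%:R^-1 <= ln (n.+1%:R : R) - ln n%:R <= n%:R^-1.
Proof.
move=> n0; have n0R : 0 < n%:R :> R by rewrite ltr0n.
have n1R : 0 < n.+1%:R :> R by rewrite ltr0n.
have nV : 0 < n%:R^-1 :> R by rewrite invr_gt0.
have n1V : 0 < n.+1%:R^-1 :> R by rewrite invr_gt0.
have := ln_le_subr1 (mulr_gt0 n1R nV); have := ln_le_subr1 (mulr_gt0 n0R n1V).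
rewrite !lnM ?posrE // !lnV ?posrE //.
have -> : n%:R / n.+1%:R - 1 = - n.+1%:R^-1 :> R.
  rewrite -[X in X / _](addrK 1) natr1 mulrBl divff ?gt_eqF // mul1r.
  by rewrite addrAC subrr add0r.
have -> : n.+1%:R / n%:R - 1 = n%:R^-1 :> R.
  by rewrite -natr1 mulrDl divff ?gt_eqF // mul1r addrAC subrr add0r.
by move=> h1 h2; rewrite h2 andbT -lerN2 opprB.
Qed.

(** The constant 1/9 is the integral of $-t^2 \log t$ over $[0,1]$. In the induction both the
    increment of the sum and that of $n^3/9$ are $n^2/3 + O(n)$, and the growth $2n+1$ of the error
    term absorbs the difference. *)
Lemma sumsq_log_bounds (R : realType) (n : nat) :
  n%:R ^+ 3 / 9 - n%:R ^+ 2 <= sumsq_log R n <= n%:R ^+ 3 / 9 + n%:R ^+ 2.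
Proof.
elim: n => [|n IH]; first by rewrite /sumsq_log big_ord0; apply/andP; split; lra.
rewrite sumsq_logS sum_sqr; move: IH.
have [->|n0] := posnP n.
  by move=> _; rewrite /sumsq_log big_ord0 !mul0r mulr0 addr0; apply/andP; split; lra.
have n1 : 1 <= n%:R :> R by rewrite ler1n.
have /andP[] := ln_succ_bounds R n0.
rewrite -natr1; set l := ln _ - ln _; set x : R := n%:R in n1 * => l1 l2.
have xV : x * x^-1 = 1 by rewrite divff ?gt_eqF //; lra.
have x1V : (x + 1) * (x + 1)^-1 = 1 by rewrite divff ?gt_eqF //; lra.
have l1' : 1 <= l * (x + 1) by rewrite -[leLHS]x1V [leLHS]mulrC ler_wpM2r//; lra.
have l2' : l * x <= 1 by rewrite -[leRHS]xV [leRHS]mulrC ler_wpM2r//; lra.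
have e1 : x * (2 * x + 1) / 6 <= l * (x * (x + 1) * (2 * x + 1) / 6).
  rewrite (_ : l * _ = (l * (x + 1)) * (x * (2 * x + 1) / 6)); last by field.
  by rewrite ler_peMl//; nra.
have e2 : l * (x * (x + 1) * (2 * x + 1) / 6) <= (x + 1) * (2 * x + 1) / 6.
  rewrite (_ : l * _ = (l * x) * ((x + 1) * (2 * x + 1) / 6)); last by field.
  by rewrite ler_piMl//; nra.
by case/andP=> i1 i2; apply/andP; split; nra.
Qed.

(** * Asymptotics of the number of triples *)

Lemma sum_mul_lt (d m n : nat) : (0 < d)%N ->
  (\sum_(k < n) (d * k.+1 < m) = minn n (m.-1 %/ d))%N.
Proof.
move=> d0; elim: n => [|n IH]; first by rewrite big_ord0 min0n.
rewrite big_ord_recr /= IH.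
have -> : (d * n.+1 < m)%N = (n < m.-1 %/ d)%N.
  by rewrite leq_divRL // mulnC; case: m {IH} => [|m] //=; lia.
by case: ltnP => ?; lia.
Qed.

Lemma sum_mul_lt_bounds (R : realType) (d m n : nat) : (0 < d)%N -> (0 < m)%N ->
  Num.min n%:R (m%:R / d%:R) - 1 <= (\sum_(k < n) (d * k.+1 < m))%:R :> R /\
  (\sum_(k < n) (d * k.+1 < m))%:R <= Num.min n%:R (m%:R / d%:R) :> R.
Proof.
move=> d0 m0; rewrite sum_mul_lt //; set q := (_ %/ d)%N.
have d0R : 0 < d%:R :> R by rewrite ltr0n.
have q1 : q%:R <= m%:R / d%:R :> R.
  rewrite ler_pdivlMr // -natrM ler_nat.
  by apply: leq_trans (leq_trunc_div _ _) (leq_pred _).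
(* From [m.-1 < (q + 1) * d] follows [m <= (q + 1) * d], so the floor of [m.-1] costs no more than
   1. *)
have q2 : m%:R / d%:R <= q%:R + 1 :> R.
  rewrite ler_pdivrMr // natr1 -natrM ler_nat.
  by have := ltn_ceil m.-1 d0; rewrite -/q; lia.
have -> : (minn n q)%:R = Num.min n%:R q%:R :> R.
  by rewrite /Num.min ltr_nat /minn; case: ifP.
split; last by rewrite le_min !ge_min lexx q1 orbT.
rewrite le_min; apply/andP; split; rewrite lerBlDr ge_min.
  by rewrite lerDl ler01.
by rewrite q2 orbT.
Qed.

(* The value is [s * loghinge (n / (s / n))] with [s = (j + 1)^2 / 4], because
   [min n (s / x) = s * q * min 1 (1 / (q * x))] for [q = n / s]. *)
Lemma sum_min_div (R : realType) (n j : nat) : (j < n)%N ->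
  let s : R := j.+1%:R ^+ 2 / 4 * (1 + 2 * ln 2 + 2 * (ln n%:R - ln j.+1%:R)) in
  s - n%:R <= \sum_(i < n) Num.min n%:R ((j.+1 ^ 2)%:R / (4 * i.+1)%:R) /\
  \sum_(i < n) Num.min n%:R ((j.+1 ^ 2)%:R / (4 * i.+1)%:R) <= s.
Proof.
move=> jn /=.
have n0 : 0 < n%:R :> R by rewrite ltr0n (leq_ltn_trans _ jn).
have x0 : 0 < j.+1%:R :> R by rewrite ltr0n.
have xn : j.+1%:R <= n%:R :> R by rewrite ler_nat.
set x : R := j.+1%:R in x0 xn *; set y : R := n%:R in n0 xn *.
pose s := x ^+ 2 / 4; pose q := y / s.
have s0 : 0 < s by rewrite divr_gt0 ?exprn_gt0.
have q0 : 0 < q by rewrite divr_gt0.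
have sq : s * q = y by rewrite /q mulrC divfK ?gt_eqF.
have := sum_min_harmonic n q0; rewrite -/y.
have -> : loghinge (y * q) = 1 + 2 * ln 2 + 2 * (ln y - ln x).
  have -> : y * q = (2 * y / x) ^+ 2.
    by rewrite /q /s; field; rewrite gt_eqF.
  (* Since [x <= y], the argument of [loghinge] lies on its logarithmic branch. *)
  have yx1 : 1 < 2 * y / x by rewrite ltr_pdivlMr //; lra.
  rewrite /loghinge leNgt exprn_egt1 //= lnXn ?lnM ?posrE ?mulr_gt0 ?invr_gt0 //.
  by rewrite lnV ?posrE // -mulr_natl; ring.
have -> : \sum_(i < n) Num.min y ((j.+1 ^ 2)%:R / (4 * i.+1)%:R) =
    s * \sum_(i < n) q * Num.min 1 (i.+1%:R * q)^-1.
  rewrite mulr_sumr; apply: eq_bigr => i _.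
  have i0 : 0 < i.+1%:R :> R by rewrite ltr0n.
  rewrite mulrA sq minr_pMr ?ltW // mulr1; congr Num.min.
  rewrite natrX natrM -/x /q /s; field.
  by rewrite !gt_eqF.
rewrite -/s; set S := \sum_(i < n) _; set L := 1 + _ + _ => /andP[h1 h2]; split.
  by rewrite -sq -mulrBr ler_pM2l.
by rewrite ler_pM2l.
Qed.

Lemma pos_disc_triples_bounds (R : realType) (n : nat) :
  `|(pos_disc_triples n)%:R - (5 + 6 * ln 2) / 36 * n%:R ^+ 3| <= 3 * n%:R ^+ 2 :> R.
Proof.
pose s (j : nat) : R :=
  j.+1%:R ^+ 2 / 4 * (1 + 2 * ln 2 + 2 * (ln n%:R - ln j.+1%:R)).
(* Of the loss [2 * n%:R], one half comes from the floors, at most 1 for each [i], and the other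
   from comparing the sum with the integral. *)
have main (j : 'I_n) :
    s j - 2 * n%:R <= (\sum_(i < n) \sum_(k < n) (4 * i.+1 * k.+1 < j.+1 ^ 2))%:R /\
    (\sum_(i < n) \sum_(k < n) (4 * i.+1 * k.+1 < j.+1 ^ 2))%:R <= s j.
  have [l1 l2] := sum_min_div R (ltn_ord j); rewrite -/(s j) in l1 l2.
  rewrite natr_sum; split.
    suff : \sum_(i < n) Num.min n%:R ((j.+1 ^ 2)%:R / (4 * i.+1)%:R) - n%:R <=
      \sum_(i < n) (\sum_(k < n) (4 * i.+1 * k.+1 < j.+1 ^ 2))%:R :> R by lra.
    rewrite -[X in _ - X%:R]card_ord -sumr_const -sumrB; apply: ler_sum => i _.
    by have [] := @sum_mul_lt_bounds R (4 * i.+1) (j.+1 ^ 2) n.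
  apply: le_trans l2; apply: ler_sum => i _.
  by have [] := @sum_mul_lt_bounds R (4 * i.+1) (j.+1 ^ 2) n.
have sumE : \sum_(j < n) s j =
    (1 + 2 * ln 2) / 4 * (n%:R * (n%:R + 1) * (2 * n%:R + 1) / 6) + sumsq_log R n / 2.
  rewrite -sum_sqr /sumsq_log mulr_sumr mulr_suml -big_split /=.
  by apply: eq_bigr => j _; rewrite /s; field.
have lo : \sum_(j < n) s j - 2 * n%:R ^+ 2 <= (pos_disc_triples n)%:R.
  rewrite natr_sum.
  have -> : 2 * n%:R ^+ 2 = \sum_(j < n) 2 * n%:R :> R.
    by rewrite sumr_const card_ord -mulr_natr; ring.
  by rewrite -sumrB; apply: ler_sum => j _; have [] := main j.
have up : (pos_disc_triples n)%:R <= \sum_(j < n) s j.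
  by rewrite natr_sum; apply: ler_sum => j _; have [] := main j.
move: lo up; rewrite {}sumE => lo up.
have l0 : 0 <= ln 2 :> R by rewrite ln_ge0 // ler1n.
have l1 : ln 2 <= 1 :> R by have := @ln_le_subr1 R 2; lra.
have /andP[w1 w2] := sumsq_log_bounds R n.
have [n0|n0] := posnP n.
  move: lo up w1 w2; rewrite n0 => lo up w1 w2.
  by rewrite ler_norml; apply/andP; split; lra.
have n1 : 1 <= n%:R :> R by rewrite ler1n.
set x : R := n%:R in lo up w1 w2 n1 *; set l : R := ln 2 in lo up l0 l1 *.
have p1 : x ^+ 3 / 3 <= x * (x + 1) * (2 * x + 1) / 6 by nra.
have p2 : x * (x + 1) * (2 * x + 1) / 6 <= x ^+ 3 / 3 + x ^+ 2 by nra.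
move: lo up p1 p2; set P := _ / 6 => lo up p1 p2.
have r1 : (1 + 2 * l) / 4 * (x ^+ 3 / 3) <= (1 + 2 * l) / 4 * P.
  by rewrite ler_wpM2l; lra.
have r2 : (1 + 2 * l) / 4 * P <= (1 + 2 * l) / 4 * (x ^+ 3 / 3 + x ^+ 2).
  by rewrite ler_wpM2l; lra.
have r3 : l * x ^+ 2 <= x ^+ 2 by rewrite ler_piMl ?sqr_ge0.
have x2 : 0 <= x ^+ 2 by rewrite sqr_ge0.
(* The main terms add up to $(1 + 2l)/12 + 1/18 = (5 + 6l)/36$. As $l \le 1$, the error is at most
   $5x^2/4$ above and $5x^2/2$ below. *)
by rewrite ler_norml; apply/andP; split; lra.
Qed.

(** * Passage to the limit *)

Theorem theorem1p3 (R : realType) :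
  (fun H : nat => (D2 R H)%:R / (2 * H%:R) ^+ 3 : R) @ \oo -->
    ((41 + 6 * ln 2) / 72 : R).
Proof.
set l : R := _ / 72.
have bound n : `|(D2 R n.+1)%:R / (2 * n.+1%:R) ^+ 3 - l| <= 2 * n.+1%:R^-1.
  have n1 : 1 <= n.+1%:R :> R by rewrite ler1n.
  rewrite D2E natrM !natrD !natrX; have := pos_disc_triples_bounds R n.+1.
  set x : R := n.+1%:R in n1 *; set t : R := (pos_disc_triples n.+1)%:R => tb.
  have x0 : 0 < x by lra.
  (* The cubic terms cancel because $1/2 + (5 + 6 \log 2)/72 = (41 + 6 \log 2)/72$; the remaining
     numerator is at most $x^2 + 3x^2$ in absolute value. *)
  have -> : 4%:R * (x ^+ 2 + x ^+ 3 + t) / (2 * x) ^+ 3 - l =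
      (x ^+ 2 + (t - (5 + 6 * ln 2) / 36 * x ^+ 3)) / 2 / x ^+ 3.
    by rewrite /l; field; rewrite gt_eqF.
  have -> : 2 * x^-1 = (4 * x ^+ 2) / 2 / x ^+ 3 by field; rewrite gt_eqF.
  have x3 : 0 < (x ^+ 3)^-1 by rewrite invr_gt0 exprn_gt0.
  rewrite normrM (gtr0_norm x3) ler_pM2r // normrM (gtr0_norm (_ : 0 < 2^-1)) //.
  rewrite ler_pM2r //; apply: le_trans (ler_normD _ _) _.
  by rewrite ger0_norm ?sqr_ge0 //; lra.
apply/(@cvgrPdist_le _ R^o) => e e0.
(* The successor rules out [H = 0], to which [bound] does not apply. *)
exists (Num.bound (2 / e)).+1 => // -[//|n] /= nb.
rewrite distrC; apply: le_trans (bound n) _.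
rewrite ler_pdivrMr ?ltr0n // mulrC.
have : 2 / e < (Num.bound (2 / e))%:R by rewrite archi_boundP // divr_ge0 // ltW.
have : (Num.bound (2 / e))%:R <= n.+1%:R :> R by rewrite ler_nat; lia.
move=> h1 h2; have := ltW (lt_le_trans h2 h1).
by rewrite ler_pdivrMr.
Qed.
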